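(* Let $f$ be a piecewise affine map (PAM) with intervals $X_1,\dots,X_l$ and $f(x)=a_ix+b_i$ for $x\in X_i$, with all $a_i\neq 0$. Let $\mathbb{F}=\{p_1,\dots,p_k\}$ be the associated finite set of primes, and let $A_f=(a_{ji})$ be the matrix with entries $a_{ji}=\|a_i\|_{p_j}$, $1\le i\le l$, $1\le j\le k$. If every row of $A_f$ contains values of the same sign, i.e. $a_{ji}\cdot a_{ji'}\ge 0$ for all $1\le j\le k$ and $1\le i,i'\le l$, then the (point-to-point) reachability problem for $f$ is decidable.
   Context: $S^1=\mathbb{Q}/\mathbb{Z}$ denotes the rational unit circle, identified with the set of rational numbers in $[0,1)$. A map $f:S^1\to S^1$ is a one-dimensional piecewise affine map (PAM) if $S^1=X_1\cup\dots\cup X_l$ for a finite family of disjoint intervals $X_1,\dots,X_l$ with rational endpoints, and $f(x)=a_ix+b_i$ for $x\in X_i$, where $a_i,b_i\in\mathbb{Q}$. For a nonzero rational $x=p^{\alpha_p}r/s$ with $p$ prime and $r,s$ integers not divisible by $p$, the $p$-adic weight of $x$ is $\|x\|_p=-\alpha_p$ (the base-$p$ logarithm of the $p$-adic norm $|x|_p=p^{-\alpha_p}$). $\mathbb{F}=\{p_1,\dots,p_k\}$ is a finite set of primes containing all primes occurring in the prime factorizations (numerators and denominators) of the coefficients $a_i$, as well as all primes occurring in the denominators of the $b_i$ and of the points considered (enlarging $\mathbb{F}$ further only adds zero rows to $A_f$). The orbit of $x$ is $O_f(x)=\{f^i(x)\mid i\in\{0,1,2,\ldots\}\}$. The (point-to-point)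 reachability problem for $f$ is: given rational points $x,y\in S^1$, decide whether $y\in O_f(x)$. *)

(* Defs.v *)
From HB Require Import structures.
From mathcomp Require Import all_boot all_order all_algebra.

Set Implicit Arguments.
Unset Strict Implicit.
Unset Printing Implicit Defensive.

Import Order.TTheory GRing.Theory Num.Theory.
Local Open Scope ring_scope.

(* Partial recursive functions, as syntax indexed by arity together with
   their (relational, possibly undefined) semantics. Decidability is stated
   through this model because [{P} + {~ P}] and boolean-valued Rocq functions
   carry no computational content once classical axioms are allowed. *)
Inductive recfun : nat -> Type :=
| RZero n : recfun n
| RSucc : recfun 1
| RProj n (i : 'I_n) : recfun n
| RComp m n (g : recfun m) (h : 'I_m -> recfun n) : recfun n
| RPrim n (g : recfun n) (h : recfun n.+2) : recfun n.+1
| RMin n (g : recfun n.+1) : recfun n.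

(* [reval e x v]: [e] is defined on the arguments [x], with value [v].
   - [RPrim g h] is F(0, y) = g(y), F(k + 1, y) = h(k, F(k, y), y); the
     function [s] below lists the values F(0, y), ..., F(k, y).
   - [RMin g] is the least k with g(k, x) = 0, and requires g to be defined
     (and nonzero) at all smaller values. *)
Fixpoint reval (n : nat) (e : recfun n) : n.-tuple nat -> nat -> Prop :=
  match e in recfun n return n.-tuple nat -> nat -> Prop with
  | RZero _ => fun _ v => v = 0%N
  | RSucc => fun x v => v = (thead x).+1
  | RProj _ i => fun x v => v = tnth x i
  | RComp m _ g h => fun x v =>
      exists y : m.-tuple nat,
        (forall i, reval (h i) x (tnth y i)) /\ reval g y v
  | RPrim _ g h => fun x v =>
      let k := thead x in let y := [tuple of behead x] in
      exists s : nat -> nat,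
        [/\ reval g y (s 0%N),
            forall i, (i < k)%N ->
              reval h [tuple of [:: i, s i & y]] (s i.+1)
          & v = s k]
  | RMin _ g => fun x v =>
      reval g [tuple of v :: x] 0%N /\
      forall i, (i < v)%N -> exists w, reval g [tuple of i :: x] w.+1
  end.

(* A decision problem: instances of type [I], presented to the algorithm
   through [code], and the set [P] of positive instances. *)
Definition decidable_problem (I : Type) (k : nat) (code : I -> k.-tuple nat)
    (P : I -> Prop) : Prop :=
  exists e : recfun k, forall x : I,
    (P x -> reval e (code x) 1%N) /\ (~ P x -> reval e (code x) 0%N).

(* S^1 = Q/Z, each class being represented by its element in [0, 1). *)
Definition S1 : Type := {x : rat | 0 <= x < 1}.

(* Equality in Q/Z. *)
Definition eq_mod1 (x y : rat) : Prop := exists z : int, x - y = z%:~R.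

(* The first clause says both that each [X i] lies in [0, 1) and that the
   [X i] cover it. An [interval rat] has arbitrary open or closed ends, so
   singletons are allowed. The affine formula is evaluated at the
   representative of x in [0, 1), and is an equality in Q/Z. *)
Definition is_PAM (l : nat) (X : 'I_l -> interval rat) (a b : 'I_l -> rat)
    (f : S1 -> S1) : Prop :=
  [/\ forall x : rat, 0 <= x < 1 <-> exists i, x \in X i,
      forall (i j : 'I_l) (x : rat), x \in X i -> x \in X j -> i = j
    & forall (i : 'I_l) (x : S1), val x \in X i ->
        eq_mod1 (val (f x)) (a i * val x + b i)].

(* For x <> 0, this is minus the exponent of p in x = p^alpha r / s. *)
Definition padic_weight (p : nat) (x : rat) : int :=
  (logn p `|denq x|)%:Z - (logn p `|numq x|)%:Z.

(* Every prime occurring in the numerator or denominator of some a_i, or in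
   the denominator of some b_i, is listed in [p]. Primes dividing the
   denominators of the points of an instance need not be listed: they would
   only add zero rows to the matrix of weights. *)
Definition prime_family (l k : nat) (a b : 'I_l -> rat) (p : 'I_k -> nat)
    : Prop :=
  [/\ forall j, prime (p j),
      injective p
    & forall (i : 'I_l) (q : nat), prime q ->
        [|| q %| `|numq (a i)|, q %| `|denq (a i)| | q %| `|denq (b i)|]%N ->
        exists j, p j = q].

Definition weight_matrix (l k : nat) (a : 'I_l -> rat) (p : 'I_k -> nat)
    : 'M[int]_(k, l) :=
  \matrix_(j < k, i < l) padic_weight (p j) (a i).

Definition orbit_of (T : Type) (f : T -> T) (x y : T) : Prop :=
  exists n : nat, y = iter n f x.

(* Numerators and denominators in lowest terms. *)
Definition pair_code (xy : S1 * S1) : 4.-tuple nat :=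
  [tuple `|numq (val xy.1)|%N; `|denq (val xy.1)|%N;
         `|numq (val xy.2)|%N; `|denq (val xy.2)|%N].

Definition reachability_decidable (f : S1 -> S1) : Prop :=
  decidable_problem pair_code (fun xy => orbit_of f xy.1 xy.2).

(* Main.v *)
(* Fix a prime q. If no a_i has q in its denominator, the exponent of q in the
   denominators along an orbit is bounded by the one of the starting point x
   and those of the b_i. If no a_i has q in its numerator, the inverse branches
   have this property, and the exponent at a point of the orbit is bounded by
   the one of any later point and those of the b_i. The sign condition on the
   rows says that every prime falls in one of these cases, so all points on the
   way from x to y have denominators dividing D = den(x) den(y) prod_i den(b_i).
   There are only D such points in [0, 1): if y is reached at all, it is reached
   in fewer than D steps, and it suffices to run f that long. *)

Require Import Defs.
From HB Require Import structures.
From mathcomp Require Import all_boot all_order all_algebra.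
From mathcomp Require Import zify ring lra.

Set Implicit Arguments.
Unset Strict Implicit.

Import Order.TTheory GRing.Theory Num.Theory.
Local Open Scope ring_scope.

(** * Closure properties of computable functions *)

(* Only the values of [F] at sequences of size [n] matter. *)
Definition computes (n : nat) (F : seq nat -> nat) : Prop :=
  exists e : recfun n, forall x : n.-tuple nat, reval e x (F x).

Lemma eq_computes n F G :
  (forall s, size s = n -> F s = G s) -> computes n F -> computes n G.
Proof.
by move=> eqFG [e eF]; exists e => x; rewrite -eqFG ?size_tuple.
Qed.

Lemma computes_nth n i : (i < n)%N -> computes n (fun s => nth 0%N s i).
Proof.
by move=> lt_in; exists (RProj (Ordinal lt_in)) => x /=; rewrite (tnth_nth 0%N).
Qed.

Lemma computes_comp n F (gs : seq (seq nat -> nat)) :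
    computes (size gs) F ->
    (forall i, (i < size gs)%N -> computes n (nth (fun=> 0%N) gs i)) ->
  computes n (fun s => F [seq g s | g <- gs]).
Proof.
move=> [e eF] gsP.
have /fin_all_exists[e' e'P] (i : 'I_(size gs)) :
    exists e' : recfun n, forall x, reval e' x (nth (fun=> 0%N) gs i x).
  by have [e' e'P] := gsP i (ltn_ord i); exists e'.
exists (RComp e e') => x /=.
exists (map_tuple (fun g => g (tval x)) (in_tuple gs)).
split=> [i|]; last exact: eF.
by rewrite (tnth_nth 0%N) /= (nth_map (fun=> 0%N)).
Qed.

(** Weakening by [k] leading arguments. With [k = 2] it skips the counter and the previous value
    that [RPrim] puts in front of the parameters. *)
Lemma computes_drop k n F :
  computes n F -> computes (k + n) (fun s => F (drop k s)).
Proof.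
move=> cF; pose gs := [seq (fun s => nth 0%N s (k + i)) | i <- iota 0 n].
have sz_gs : size gs = n by rewrite size_map size_iota.
apply: (@eq_computes _ (fun s => F [seq g s | g <- gs])) => [s sz_s|].
  congr F; rewrite -map_comp.
  apply: (@eq_from_nth _ 0%N) => [|i].
    by rewrite size_map size_iota size_drop sz_s addKn.
  rewrite size_map size_iota => lt_in.
  by rewrite (nth_map 0%N) ?size_iota //= nth_iota // nth_drop.
apply: computes_comp => [|i]; rewrite sz_gs // => lt_in.
rewrite (nth_map 0%N) ?size_iota // nth_iota //.
by apply: computes_nth; rewrite ltn_add2l.
Qed.

Lemma computes_S n F : computes n F -> computes n (fun s => (F s).+1).
Proof.
move=> cF; apply: (@computes_comp n (fun s => (head 0%N s).+1) [:: F]).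
  by exists RSucc => x; case/tupleP: x => i x.
by case.
Qed.

Lemma computes_cst n c : computes n (fun=> c).
Proof.
by elim: c => [|c IHc]; [exists (RZero n) | apply: computes_S].
Qed.

(** [RPrim] recurses on its first argument only. A computed recursion bound [k s] is obtained by
    composing with [k] followed by all projections. *)
Lemma computes_rec n (g k : seq nat -> nat) (h : nat -> nat -> seq nat -> nat) :
    computes n g ->
    computes n.+2 (fun s => h (nth 0%N s 0) (nth 0%N s 1) (drop 2 s)) ->
    computes n k ->
  computes n (fun s => nat_rec (fun=> nat) (g s) (fun i r => h i r s) (k s)).
Proof.
move=> [eg egP] [eh ehP] ck.
pose R s := nat_rec (fun=> nat) (g (behead s))
  (fun i r => h i r (behead s)) (head 0%N s).
have cR : computes n.+1 R.
  exists (RPrim eg eh) => x; case/tupleP: x => m x.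
  pose y := [tuple of behead [tuple of m :: x]].
  exists (nat_rec (fun=> nat) (g y) (fun i r => h i r y)); split=> // i _.
  have := ehP [tuple of [:: i, nat_rec (fun=> nat) (g y)
    (fun i r => h i r y) i & y]].
  by rewrite /= drop0.
pose gs := k :: [seq (fun s => nth 0%N s i) | i <- iota 0 n].
have sz_gs : size gs = n.+1 by rewrite /= size_map size_iota.
apply: (@eq_computes _ (fun s => R [seq g s | g <- gs])) => [s sz_s|].
  suff sE : [seq g s | g <- behead gs] = s by rewrite /R /= sE.
  by rewrite -map_comp -[RHS](mkseq_nth 0%N) sz_s.
apply: computes_comp; rewrite sz_gs // => -[|i] // lt_in.
rewrite /= (nth_map 0%N) ?size_iota // nth_iota //.
exact: computes_nth.
Qed.

Lemma computes_add n F G :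
  computes n F -> computes n G -> computes n (fun s => F s + G s)%N.
Proof.
move=> cF cG; pose h (i r : nat) (s : seq nat) := r.+1.
apply: eq_computes (@computes_rec _ F G h cF _ cG) => [s _|].
  by elim: (G s) => [|m IHm]; rewrite ?addn0 //= addnS -IHm.
by apply/computes_S/computes_nth.
Qed.

Lemma computes_pred n F : computes n F -> computes n (fun s => (F s).-1).
Proof.
(* The recursion returns its last counter, which is one less than the bound. *)
move=> cF; pose h (i r : nat) (s : seq nat) := i.
apply: eq_computes (@computes_rec _ _ F h (computes_cst n 0) _ cF) => [s _|].
  by case: (F s).
exact: computes_nth.
Qed.

Lemma computes_sub n F G :
  computes n F -> computes n G -> computes n (fun s => F s - G s)%N.
Proof.
move=> cF cG; pose h (i r : nat) (s : seq nat) := r.-1.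
apply: eq_computes (@computes_rec _ F G h cF _ cG) => [s _|].
  by elim: (G s) => [|m IHm]; rewrite ?subn0 //= subnS -IHm.
by apply/computes_pred/computes_nth.
Qed.

Lemma computes_bounded_sum n k (H : nat -> seq nat -> nat) :
    computes n k -> computes n.+2 (fun s => H (nth 0%N s 0) (drop 2 s)) ->
  computes n (fun s => \sum_(i < k s) H i s)%N.
Proof.
move=> ck cH; pose h i r s := (r + H i s)%N.
apply: eq_computes (@computes_rec _ _ k h (computes_cst n 0) _ ck) => [s _|].
  by elim: (k s) => [|m IHm]; rewrite ?big_ord0 //= big_ord_recr /= -IHm.
by apply: computes_add => //; apply: computes_nth.
Qed.

Lemma computes_mul n F G :
  computes n F -> computes n G -> computes n (fun s => F s * G s)%N.
Proof.
move=> cF cG.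
apply: eq_computes (@computes_bounded_sum n G (fun=> F) cG _) => [s _|].
  by rewrite sum_nat_const card_ord mulnC.
exact: (computes_drop 2 cF).
Qed.

Lemma computes_exp n c F : computes n F -> computes n (fun s => c ^ F s)%N.
Proof.
move=> cF; pose h (i r : nat) (s : seq nat) := (c * r)%N.
apply: eq_computes (@computes_rec _ _ F h (computes_cst n 1) _ cF) => [s _|].
  by elim: (F s) => [|m IHm] //=; rewrite expnS -IHm.
by apply: computes_mul; [apply: computes_cst | apply: computes_nth].
Qed.

Lemma computes_leq n F G :
  computes n F -> computes n G -> computes n (fun s => F s <= G s : nat)%N.
Proof.
move=> cF cG.
apply: (@eq_computes _ (fun s => 1 - (F s - G s))%N) => [s _|].
  by rewrite [in RHS]/leq; case: (F s - G s)%N => // m; rewrite subSS sub0n.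
by apply: computes_sub (computes_cst n 1) _; apply: computes_sub.
Qed.

Lemma computes_eqn n F G :
  computes n F -> computes n G -> computes n (fun s => F s == G s : nat)%N.
Proof.
move=> cF cG.
apply: (@eq_computes _ (fun s => (F s <= G s) * (G s <= F s))%N) => [s _|].
  by rewrite eqn_leq mulnb.
by apply: computes_mul; apply: computes_leq.
Qed.

(** A counter runs for [F s] steps and is reset to 0 on reaching [G s]. If [G s] is 0 it is never
    reset, in agreement with [m %% 0 = m]. *)
Lemma computes_mod n F G :
  computes n F -> computes n G -> computes n (fun s => F s %% G s)%N.
Proof.
move=> cF cG; pose h (i r : nat) s := (r.+1 * (1 - (r.+1 == G s)))%N.
apply: eq_computes (@computes_rec _ _ F h (computes_cst n 0) _ cF) => [s _|].
  elim: (F s) => [|m IHm] /=; first by rewrite mod0n.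
  rewrite IHm /h; have [->|d0] := posnP (G s); first by rewrite !modn0 muln1.
  have [rE|r_neq] := eqVneq (m %% G s).+1 (G s).
    by rewrite muln0 -addn1 -modnDml addn1 rE modnn.
  rewrite muln1 -[in RHS]addn1 -modnDml addn1 [RHS]modn_small //.
  by rewrite ltn_neqAle r_neq ltn_mod.
have c1 : computes n.+2 (fun s => (nth 0%N s 1).+1).
  by apply/computes_S/computes_nth.
apply: computes_mul => //; apply: computes_sub; first exact: computes_cst.
by apply: computes_eqn => //; apply: (computes_drop 2).
Qed.

Lemma computes_sum n l (H : 'I_l -> seq nat -> nat) :
  (forall i, computes n (H i)) -> computes n (fun s => \sum_i H i s)%N.
Proof.
elim: l => [|l IHl] in H * => cH.
  by apply: (eq_computes _ (computes_cst n 0)) => s _; rewrite big_ord0.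
pose F s := (\sum_(i < l) H (widen_ord (leqnSn l) i) s + H ord_max s)%N.
apply: (@eq_computes _ F) => [s _|]; first by rewrite big_ord_recr.
by apply: computes_add => //; apply: IHl.
Qed.

(** * Piecewise affine maps acting on numerators and denominators *)

(** Closure under substitution, so that [g] can be used at any arity. It is applied to the numerator
    and denominator of a point. *)
Definition computable2 (g : nat -> nat -> nat) : Prop :=
  forall n F G, computes n F -> computes n G ->
  computes n (fun s => g (F s) (G s)).

Lemma int_subn (z : int) : exists P N : nat, z = P%:Z - N%:Z.
Proof. by case: z => m; [exists m, 0%N | exists 0%N, m.+1]; lia. Qed.

Lemma rat_subn (r : rat) :
  exists P N D : nat, (0 < D)%N /\ r * D%:R = P%:R - N%:R.
Proof.
have [P [N nE]] := int_subn (numq r); exists P, N, `|denq r|%N.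
split; first by rewrite absz_gt0 denq_neq0.
rewrite natr_absz ger0_norm ?denq_ge0 //.
by rewrite -numqE nE rmorphB.
Qed.

Lemma computable2_negb (t : nat -> nat -> bool) :
  computable2 t -> computable2 (fun u d => ~~ t u d).
Proof.
move=> ct n F G cF cG; apply: (@eq_computes _ (fun s => 1 - t (F s) (G s))%N).
  by move=> s _; case: (t _ _).
by apply: computes_sub; [apply: computes_cst | apply: ct].
Qed.

(** Clearing denominators with [r = (P - N) / D] turns [r <= u / d] into an inequality between
    naturals. For [b = false] the inequality is strict, hence the summand [~~ b]. *)
Lemma computable2_itv_bound (c : itv_bound rat) :
  exists t : nat -> nat -> bool, computable2 t /\
    forall u d, (0 < d)%N -> t u d = (c <= BLeft (u%:R / d%:R))%O.
Proof.
case: c => [b r|[]].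
- have [P [N [D [D0 rE]]]] := rat_subn r.
  exists (fun u d => P * d + ~~ b <= D * u + N * d)%N.
  split=> [n F G cF cG|u d d0].
    have cM c H : computes n H -> computes n (fun s => c * H s)%N.
      by apply: computes_mul; apply: computes_cst.
    by apply: computes_leq; apply: computes_add; do ?apply: cM;
      do ?apply: computes_cst.
  have D0' : 0 < D%:R :> rat by rewrite ltr0n.
  have d0' : 0 < d%:R :> rat by rewrite ltr0n.
  have rdE : r * d%:R * D%:R = P%:R * d%:R - N%:R * d%:R.
    by rewrite mulrAC rE mulrBl.
  case: b; rewrite bnd_simp /= ?addn0 ?addn1.
    rewrite ler_pdivlMr // -(ler_pM2r D0') rdE -(ler_nat rat).
    by rewrite natrD !natrM; apply/idP/idP; lra.
  rewrite ltr_pdivlMr // -(ltr_pM2r D0') rdE -(ltr_nat rat).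
  by rewrite natrD !natrM; apply/idP/idP; lra.
- exists (fun _ _ => true); split=> // n F G _ _; exact: computes_cst.
- exists (fun _ _ => false); split=> // n F G _ _; exact: computes_cst.
Qed.

Lemma computable2_itv (I : interval rat) : exists t : nat -> nat -> bool,
  computable2 t /\ forall u d, (0 < d)%N -> t u d = (u%:R / d%:R \in I).
Proof.
case: I => c1 c2.
have [t1 [ct1 t1P]] := computable2_itv_bound c1.
have [t2 [ct2 t2P]] := computable2_itv_bound c2.
exists (fun u d => t1 u d && ~~ t2 u d); split=> [n F G cF cG|u d d0].
  apply: (@eq_computes _ (fun s => t1 (F s) (G s) * ~~ t2 (F s) (G s))%N).
    by move=> s _; rewrite mulnb.
  by apply: computes_mul; [apply: ct1 | apply: (computable2_negb ct2)].
(* The upper condition [BRight x <= c2] is the negation of [c2 <= BLeft x], since no bound lies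
   strictly between [BLeft x] and [BRight x]. *)
rewrite t1P // t2P // itv_boundlr; congr andb.
by case: c2 {t2 ct2 t2P} => [[] r|[]] //; rewrite !bnd_simp ?ltNge ?negbK.
Qed.

Definition affine_den (l : nat) (a b : 'I_l -> rat) : nat :=
  (\prod_i (`|denq (a i)| * `|denq (b i)|))%N.

Lemma affine_den_gt0 l (a b : 'I_l -> rat) : (0 < affine_den a b)%N.
Proof. by rewrite prodn_gt0 // => i; rewrite muln_gt0 !absz_gt0 !denq_neq0. Qed.

Lemma mul_den_int (r : rat) (m : nat) :
  (`|denq r| %| m)%N -> exists z : int, m%:R * r = z%:~R.
Proof.
case/dvdnP=> c ->; exists (c%:Z * numq r).
by rewrite natrM natr_absz ger0_norm ?denq_ge0 // -mulrA [_ * r]mulrC -numqE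
  intrM.
Qed.

(** The denominator divides [m * numq r] and is coprime to [numq r]. *)
Lemma den_dvd (r : rat) (m z : int) :
  m%:~R * r = z%:~R -> (`|denq r| %| `|m|)%N.
Proof.
move=> mrE; have E : m * numq r = z * denq r.
  by apply: (@intr_inj rat); rewrite !intrM -mrE numqE mulrA.
have /Gauss_dvdl <- : coprime `|denq r| `|numq r|.
  by rewrite coprime_sym coprime_num_den.
by have := congr1 absz E; rewrite !abszM => ->; apply: dvdn_mull.
Qed.

Lemma computable2_affine (a b : rat) (C : nat) :
    (0 < C)%N -> (`|denq a| %| C)%N -> (`|denq b| %| C)%N ->
  exists h : nat -> nat -> nat, computable2 h /\
    forall u d, (0 < d)%N -> (u <= d)%N ->
    eq_mod1 ((h u d)%:R / (C * d)%:R) (a * (u%:R / d%:R) + b).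
Proof.
move=> C0 /mul_den_int[za aE] /mul_den_int[zb bE].
have [P [N zaE]] := int_subn za.
pose M := (`|zb| + N)%N; pose B := absz (zb + (C * M)%:Z).
have BE : B%:Z = zb + (C * M)%:Z.
  by rewrite /B gez0_abs //; rewrite /M; nia.
have NB : (N <= B)%N by rewrite -lez_nat BE /M; nia.
(* [B / C] is [b] shifted by the integer [M], large enough for the truncated
   subtraction to be exact. *)
exists (fun u d => P * u + B * d - N * u)%N; split=> [n F G cF cG|u d d0 ud].
  have cM c H : computes n H -> computes n (fun s => c * H s)%N.
    by apply: computes_mul; apply: computes_cst.
  by apply: computes_sub; do ?apply: computes_add; apply: cM.
exists M%:Z.
(* This is where [u <= d] enters: [N * u <= N * d <= B * d]. *)
have NuBd : (N * u <= P * u + B * d)%N by nia.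
have C0' : C%:R != 0 :> rat by rewrite pnatr_eq0 -lt0n.
have d0' : d%:R != 0 :> rat by rewrite pnatr_eq0 -lt0n.
have BE' : B%:R = C%:R * b + C%:R * M%:R :> rat.
  by rewrite bE -natrM !(pmulrn 1) BE rmorphD.
have aE' : P%:R = C%:R * a + N%:R :> rat.
  by rewrite aE zaE rmorphB /= subrK.
rewrite natrB // natrD !natrM BE' aE' -pmulrn; field.
by rewrite C0' d0'.
Qed.

(** Both sides lie in [[0, 1)] and differ by an integer, which must be 0. *)
Lemma eq_mod1_modn (x : S1) (m n : nat) (r : rat) : (0 < n)%N ->
    eq_mod1 (val x) r -> eq_mod1 (m%:R / n%:R) r ->
  val x = (m %% n)%:R / n%:R.
Proof.
move=> n0 [z1 E1] [z2 E2].
have n0' : 0 < n%:R :> rat by rewrite ltr0n.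
have n0'' : n%:R != 0 :> rat by rewrite gt_eqF.
have [y0 y1] : 0 <= (m %% n)%:R / n%:R :> rat /\ (m %% n)%:R / n%:R < 1 :> rat.
  by rewrite divr_ge0 ?ler0n // ltr_pdivrMr // mul1r ltr_nat ltn_mod.
have mE : m%:R / n%:R = (m %/ n)%:R + (m %% n)%:R / n%:R :> rat.
  by rewrite {1}(divn_eq m n) natrD natrM mulrDl mulfK.
pose z := z1 - z2 + (m %/ n)%:Z.
have zE : val x - (m %% n)%:R / n%:R = z%:~R.
  by rewrite /z intrD intrB -E1 -E2 mE -pmulrn; ring.
have /andP[x0 x1] := valP x.
suff z0 : z = 0 by move/eqP: zE; rewrite z0 subr_eq0 => /eqP.
have : (-1)%:~R < z%:~R :> rat by rewrite -zE; lra.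
have : z%:~R < 1%:~R :> rat by rewrite -zE; lra.
by rewrite !ltr_int; lia.
Qed.

Lemma computable2_PAM (l : nat) (X : 'I_l -> interval rat) (a b : 'I_l -> rat)
    (f : S1 -> S1) : is_PAM X a b f ->
  exists C : nat, (0 < C)%N /\
  exists g : nat -> nat -> nat, computable2 g /\
    forall (x : S1) u d, (0 < d)%N -> val x = u%:R / d%:R ->
      val (f x) = (g u d)%:R / (C * d)%:R.
Proof.
move=> [Xcov Xdisj Xf]; pose C := affine_den a b; have C0 := affine_den_gt0 a b.
exists C; split=> //.
have [t tP] := fin_all_exists (fun i => computable2_itv (X i)).
have den_dvd_C i : (`|denq (a i)| %| C)%N /\ (`|denq (b i)| %| C)%N.
  rewrite /C /affine_den (bigD1 i) //= -mulnA; split; last rewrite mulnCA.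
    exact: dvdn_mulr.
  exact: dvdn_mulr.
have /fin_all_exists[h hP] i :=
  computable2_affine C0 (den_dvd_C i).1 (den_dvd_C i).2.
(* At a point of [S1] exactly one indicator [t i u d] is 1, so the sum selects the active branch;
   the remainder brings its value back to [[0, 1)]. *)
exists (fun u d => (\sum_i t i u d * h i u d) %% (C * d))%N.
split=> [n F G cF cG|x u d d0 xE].
  apply: computes_mod; last by apply: computes_mul => //; apply: computes_cst.
  apply: computes_sum => i; apply: computes_mul; first exact: (tP i).1.
  exact: (hP i).1.
have [i xi] := proj1 (Xcov _) (valP x).
have ud : (u <= d)%N.
  have /andP[_] := valP x; rewrite xE ltr_pdivrMr ?ltr0n // mul1r ltr_nat.
  exact: ltnW.
rewrite (bigD1 i) //= (tP i).2 // -xE xi mul1n big1 ?addn0 => [|j ji].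
  apply: (eq_mod1_modn (r := a i * val x + b i)); first by rewrite muln_gt0 C0.
    exact: Xf.
  by rewrite xE; apply: (hP i).2.
rewrite (tP j).2 // -xE; case xj: (_ \in X j) => //.
by rewrite (Xdisj j i _ xj xi) eqxx in ji.
Qed.

(** * Exponents of a prime in denominators *)

(** The positive part of [padic_weight q r], as numerator and denominator are coprime. *)
Definition logn_den (q : nat) (r : rat) : nat := logn q `|denq r|.

Lemma absz_denq_gt0 r : (0 < `|denq r|)%N.
Proof. by rewrite absz_gt0 denq_neq0. Qed.

Lemma logn_denD q r s :
  (logn_den q (r + s) <= maxn (logn_den q r) (logn_den q s))%N.
Proof.
rewrite /logn_den -logn_lcm ?absz_denq_gt0 //.
set m := lcmn _ _; have m0 : (0 < m)%N by rewrite lcmn_gt0 !absz_denq_gt0.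
have [z rE] := mul_den_int (dvdn_lcml `|denq r| `|denq s|).
have [w sE] := mul_den_int (dvdn_lcmr `|denq r| `|denq s|).
apply: dvdn_leq_log => //; apply: (@den_dvd _ m (z + w)).
by rewrite -pmulrn mulrDr rE sE rmorphD.
Qed.

Lemma logn_denM q r s : (logn_den q (r * s) <= logn_den q r + logn_den q s)%N.
Proof.
rewrite /logn_den -lognM ?absz_denq_gt0 //.
have [z rE] := mul_den_int (dvdnn `|denq r|).
have [w sE] := mul_den_int (dvdnn `|denq s|).
apply: dvdn_leq_log; first by rewrite muln_gt0 !absz_denq_gt0.
apply: (@den_dvd _ (`|denq r| * `|denq s|)%N (z * w)).
by rewrite -pmulrn natrM mulrACA rE sE rmorphM.
Qed.

Lemma logn_denN q r : logn_den q (- r) = logn_den q r.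
Proof. by rewrite /logn_den denqN. Qed.

Lemma logn_den_int q (z : int) : logn_den q z%:~R = 0%N.
Proof. by rewrite /logn_den denq_int logn1. Qed.

Lemma logn_denDz q r s (z : int) :
  (logn_den q (r + s + z%:~R) <= maxn (logn_den q r) (logn_den q s))%N.
Proof.
apply: leq_trans (logn_denD _ _ _) _.
by rewrite logn_den_int maxn0 logn_denD.
Qed.

Lemma logn_num_den q r : logn q `|numq r| = 0%N \/ logn q `|denq r| = 0%N.
Proof.
have [q_num|] := boolP (q %| `|numq r|)%N; last first.
  by move=> qn; left; rewrite lognE (negbTE qn) !andbF.
right; have [q_pr|q_npr] := boolP (prime q); last by rewrite lognE (negbTE q_npr).
exact/logn_coprime/(coprime_dvdl q_num)/coprime_num_den.
Qed.

Lemma padic_weight_le0 q r : padic_weight q r <= 0 -> logn_den q r = 0%N.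
Proof.
by rewrite /padic_weight /logn_den; case: (logn_num_den q r) => ->; lia.
Qed.

(** The numerator of [r] is prime to [q] and is, up to sign, a denominator of the inverse. *)
Lemma padic_weight_ge0 q r :
  r != 0 -> 0 <= padic_weight q r -> logn_den q r^-1 = 0%N.
Proof.
move=> r0 w0; have {w0} n0 : logn q `|numq r| = 0%N.
  by move: w0; rewrite /padic_weight; case: (logn_num_den q r) => ->; lia.
apply/eqP; rewrite -leqn0 -n0.
apply: dvdn_leq_log; first by rewrite absz_gt0 numq_eq0.
apply: (@den_dvd _ _ (denq r)).
by rewrite numqE mulrAC divff ?mul1r.
Qed.

(** For a listed prime, one positive entry forces its whole row to be nonnegative. An unlisted prime
    divides no denominator of an [a i], so its weights are at most 0. *)
Lemma row_sign (l k : nat) (a b : 'I_l -> rat) (p : 'I_k -> nat) (q : nat) :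
    prime_family a b p ->
    (forall (j : 'I_k) (i i' : 'I_l),
      0 <= weight_matrix a p j i * weight_matrix a p j i') ->
    prime q ->
  (forall i, padic_weight q (a i) <= 0) \/ (forall i, 0 <= padic_weight q (a i)).
Proof.
move=> [_ _ p_all] sgn q_pr.
have [/existsP[j /eqP <-]|/existsPn npq] := boolP [exists j, p j == q].
  have [/existsP[i wi]|/existsPn wn] :=
    boolP [exists i, 0 < padic_weight (p j) (a i)].
    by right=> i'; have := sgn j i i'; rewrite !mxE pmulr_rge0.
  by left=> i; rewrite leNgt.
left=> i; rewrite /padic_weight.
have nq : ~~ (q %| `|denq (a i)|)%N.
  apply/negP=> qd; have [|j pj] := p_all i q q_pr; first by rewrite qd orbT.
  by have := npq j; rewrite pj eqxx.
by rewrite [logn q `|denq _|]lognE (negbTE nq) !andbF; lia.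
Qed.

(** * Denominators along an orbit and the bound on the number of steps *)

Section Orbit.

Variables (l k : nat) (X : 'I_l -> interval rat) (a b : 'I_l -> rat).
Variables (f : S1 -> S1) (p : 'I_k -> nat).
Hypotheses (f_PAM : is_PAM X a b f) (a_neq0 : forall i, a i != 0).
Hypothesis p_family : prime_family a b p.
Hypothesis row_signP : forall (j : 'I_k) (i i' : 'I_l),
  0 <= weight_matrix a p j i * weight_matrix a p j i'.

Let B : nat := (\prod_i `|denq (b i)|)%N.

Let B_gt0 : (0 < B)%N.
Proof. by rewrite prodn_gt0 // => i; apply: absz_denq_gt0. Qed.

Lemma PAM_step x : exists i (z : int), val (f x) = a i * val x + b i + z%:~R.
Proof.
have [Xcov _ Xf] := f_PAM.
have [i xi] := proj1 (Xcov _) (valP x).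
have [z zE] := Xf i x xi.
by exists i, z; rewrite -zE addrC subrK.
Qed.

Lemma logn_den_b q i : (logn_den q (b i) <= logn q B)%N.
Proof. by apply: dvdn_leq_log => //; rewrite /B (bigD1 i) //= dvdn_mulr. Qed.

Lemma logn_den_iter q n x : (forall i, padic_weight q (a i) <= 0) ->
  (logn_den q (val (iter n f x)) <= maxn (logn_den q (val x)) (logn q B))%N.
Proof.
move=> a_le0; elim: n => [|n IHn]; first exact: leq_maxl.
rewrite iterS; have [i [z ->]] := PAM_step (iter n f x).
apply: leq_trans (logn_denDz _ _ _ _) _.
rewrite geq_max; apply/andP; split.
  by apply: leq_trans (logn_denM _ _ _) _; rewrite (padic_weight_le0 (a_le0 i)).
by rewrite leq_max logn_den_b orbT.
Qed.

Lemma logn_den_iter_rev q n x : (forall i, 0 <= padic_weight q (a i)) ->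
  (logn_den q (val x) <= maxn (logn_den q (val (iter n f x))) (logn q B))%N.
Proof.
move=> a_ge0; elim: n => [|n IHn]; first exact: leq_maxl.
rewrite iterS; move: (iter n f x) IHn => w IHn.
have [i [z fwE]] := PAM_step w.
apply: leq_trans IHn _; rewrite geq_max leq_maxr andbT.
(* The branch used at [w] is inverted; multiplying by the inverse of [a i] adds no factor [q] to the
   denominator. *)
have -> : val w = (a i)^-1 * (val (f w) + - b i + (- z)%:~R).
  by rewrite fwE intrN; field.
apply: leq_trans (logn_denM _ _ _) _.
rewrite (padic_weight_ge0 (a_neq0 i) (a_ge0 i)) add0n.
apply: leq_trans (logn_denDz _ _ _ _) _.
by rewrite logn_denN geq_max leq_maxl leq_max logn_den_b orbT.
Qed.

Definition orbit_den (x y : S1) : nat :=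
  (`|denq (val x)| * `|denq (val y)| * B)%N.

Lemma orbit_den_gt0 x y : (0 < orbit_den x y)%N.
Proof. by rewrite !muln_gt0 !absz_denq_gt0. Qed.

Lemma den_iter_dvd m n x y : (m <= n)%N -> y = iter n f x ->
  (`|denq (val (iter m f x))| %| orbit_den x y)%N.
Proof.
(* Divisibility is checked one prime at a time, since the direction of the estimate depends on the
   prime. *)
move=> le_mn yE; apply/dvdn_partP => [|q]; first exact: absz_denq_gt0.
rewrite mem_primes => /andP[q_pr _].
rewrite p_part pfactor_dvdn ?orbit_den_gt0 //.
rewrite /orbit_den !lognM ?muln_gt0 ?absz_denq_gt0 //.
rewrite -/(logn_den q (val x)) -/(logn_den q (val y)).
rewrite -/(logn_den q (val (iter m f x))).
have [a_le0|a_ge0] := row_sign p_family row_signP q_pr.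
  by have := logn_den_iter m x a_le0; lia.
(* The backward estimate starts from [y], which lies [n - m] steps after [iter m f x]. *)
have := logn_den_iter_rev (n - m) (iter m f x) a_ge0.
by rewrite -iterD subnK // -yE; lia.
Qed.

Lemma orbit_bounded x y :
  orbit_of f x y <-> exists n, (n < orbit_den x y)%N /\ y = iter n f x.
Proof.
split=> [[n0 yE0]|[n [_ yE]]]; last by exists n.
have ex_n : exists n, y == iter n f x by exists n0; apply/eqP.
case: (ex_minnP ex_n) => n /eqP yE n_min {n0 yE0 ex_n}; exists n; split=> //.
set D := orbit_den x y; have D0 : (0 < D)%N by apply: orbit_den_gt0.
(* With [n] minimal, the [n.+1] points up to [y] are distinct fractions [u / D] with [u < D], whence
   [n < D]. *)
have Dint (m : 'I_n.+1) : exists u : 'I_D,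
    val (iter m f x) = (u : nat)%:R / D%:R.
  have [z zE] := mul_den_int (den_iter_dvd (leq_ord m) yE).
  have /andP[w0 w1] := valP (iter m f x).
  have D0' : 0 < D%:R :> rat by rewrite ltr0n.
  have z0 : 0 <= z by rewrite -(ler_int rat) -zE mulr_ge0 // ltW.
  have zD : (`|z| < D)%N.
    by rewrite -(ltr_nat rat) natr_absz ger0_norm // -zE gtr_pMr.
  exists (Ordinal zD); rewrite /= natr_absz ger0_norm // -zE.
  by rewrite mulrAC divff ?mul1r // gt_eqF.
have [u uE] := fin_all_exists Dint.
suff u_inj : injective u by have := leq_card u u_inj; rewrite !card_ord.
have lt_neq (i j : 'I_n.+1) : (i < j)%N -> u i != u j.
  move=> lt_ij; apply/eqP=> eq_u.
  have eq_it : iter i f x = iter j f x by apply: val_inj; rewrite !uE eq_u.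
  (* Cutting out the cycle between [i] and [j] would reach [y] in fewer than [n] steps. *)
  have : y == iter (n - j + i) f x.
    by rewrite iterD eq_it -iterD subnK ?leq_ord //; apply/eqP.
  by move/n_min; have := ltn_ord j; lia.
move=> i j /eqP eq_u; apply: val_inj => /=.
by case: (ltngtP i j) eq_u => // /lt_neq; rewrite 1?eq_sym => /negbTE->.
Qed.

(** * The decision procedure *)

Lemma S1_natE (x : S1) :
  val x = `|numq (val x)|%N%:R / `|denq (val x)|%N%:R.
Proof.
have /andP[x0 _] := valP x.
rewrite !natr_absz !ger0_norm ?denq_ge0 ?numq_ge0 //.
by rewrite -[LHS]divq_num_den.
Qed.

Lemma orbit_decidable : reachability_decidable f.
Proof.
have [C [C0 [g [cg gP]]]] := computable2_PAM f_PAM.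
(* Unreduced fractions: the n-th denominator is explicit, so that the numerators
   satisfy a recursion on a single number and no pairing function is needed. *)
pose den s n := (C ^ n * nth 0%N s 1)%N.
pose num s := nat_rec (fun=> nat) (nth 0%N s 0)
  (fun n u => g u (den s n)).
(* Cross-multiplied equality of the [n]-th point with [y]; entries 0 to 3 of [s] are the numerator
   and denominator of [x], then those of [y]. *)
pose hit n s := (num s n * nth 0%N s 3 == nth 0%N s 2 * den s n : nat)%N.
pose bound s := (nth 0%N s 1 * nth 0%N s 3 * B)%N.
have c_drop k' n i : (i < n)%N ->
    computes (k' + n) (fun s => nth 0%N (drop k' s) i).
  by move=> lt_in; apply: computes_drop (computes_nth lt_in).
(* Arity 6: the index and accumulator of the bounded sum, then the four entries of [pair_code]. The
   recursion for [num] adds two more arguments. *)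
have c_hit : computes 6 (fun s => hit (nth 0%N s 0) (drop 2 s)).
  have c_den n F (G : seq nat -> nat) : computes n F -> computes n G ->
      computes n (fun s => C ^ F s * G s)%N.
    by move=> cF cG; apply: computes_mul => //; apply: computes_exp.
  apply: computes_eqn; apply: computes_mul.
  - apply: computes_rec; last exact: computes_nth.
      exact: (c_drop 2 4 0).
    apply: cg; first exact: computes_nth.
    apply: c_den; first exact: computes_nth.
    exact: (computes_drop 2 (c_drop 2 4 1 _)).
  - exact: (c_drop 2 4 3).
  - exact: (c_drop 2 4 2).
  - by apply: c_den; [apply: computes_nth | apply: (c_drop 2 4 1)].
have c_bound : computes 4 bound.
  by do ?apply: computes_mul; try apply: computes_cst; apply: computes_nth.
have [e eP] := computes_leq (computes_cst 4 1)
  (computes_bounded_sum c_bound c_hit).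
(* The code [e] tests whether some step below the bound hits [y], so its value is 1 or 0. *)
exists e => -[x y].
pose s := pair_code (x, y).
have den_gt0 n : (0 < den s n)%N.
  by rewrite muln_gt0 expn_gt0 C0 /= absz_denq_gt0.
have numE n : val (iter n f x) = (num s n)%:R / (den s n)%:R.
  elim: n => [|n IHn].
    by rewrite /den mul1n S1_natE.
  rewrite iterS (gP _ _ _ (den_gt0 n) IHn) /=.
  by rewrite /den expnS mulnA.
have hitE n : hit n s = (y == iter n f x) :> nat.
  rewrite /hit -(inj_eq val_inj) numE S1_natE eqr_div ?pnatr_eq0 -?lt0n //.
    by rewrite -!natrM eqr_nat eq_sym.
  exact: absz_denq_gt0.
suff reachE : (1 <= \sum_(n < bound s) hit n s)%N <-> orbit_of f x y.
  have := eP s; case: leqP reachE => _ [reach orb] es; split=> //=.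
  - by move/orb.
  - by case; apply: reach.
(* By conversion [bound s] is [orbit_den x y]. *)
apply: iff_trans (iff_sym (orbit_bounded x y)).
rewrite lt0n sum_nat_eq0 negb_forall; split=> [/existsP[n]|[n [lt_n yE]]].
  rewrite hitE eqb0 negbK => /eqP yE.
  by exists n; split.
by apply/existsP; exists (Ordinal lt_n); rewrite hitE eqb0 negbK; apply/eqP.
Qed.

End Orbit.

Theorem theorem2 (l k : nat) (X : 'I_l -> interval rat) (a b : 'I_l -> rat)
    (f : S1 -> S1) (p : 'I_k -> nat)
    (hf : is_PAM X a b f)
    (ha : forall i : 'I_l, a i != 0)
    (hp : prime_family a b p)
    (hsign : forall (j : 'I_k) (i i' : 'I_l),
      0 <= weight_matrix a p j i * weight_matrix a p j i') :
  reachability_decidable f.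
Proof. exact: orbit_decidable hf ha hp hsign. Qed.
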